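(* Let $(\gamma,\widetilde\gamma)$ be a non-helical and non-planar Bertrand pair in Euclidean 3-space ($\gamma$ the Bertrand curve, $\widetilde\gamma$ its mate). Let $\widetilde\kappa,\widetilde\tau$ be the curvature and torsion of $\widetilde\gamma$, let $'$ be the derivative with respect to the arclength $s^{*}$ of $\widetilde\gamma$, and put $\widetilde f=\widetilde\tau/\widetilde\kappa$, $\widetilde g=\widetilde\tau'/\widetilde\kappa'$. Then the tangent indicatrix $\gamma_t=T$ of the Bertrand curve $\gamma$ is a spherical helix if and only if $$\widetilde\kappa''\widetilde\kappa\,\widetilde f^{2}-3\widetilde\kappa'^{2}\,\widetilde g\,\widetilde f+\widetilde\kappa''\widetilde\kappa-3\widetilde\kappa'^{2}=0$$ holds identically.
   Context: Curves are smooth regular curves in $\mathbb{R}^3$ with non-vanishing curvature; $\gamma$ is parameterized by arclength $s$ with Frenet frame $T,N,B$, and $\widetilde\gamma$ by arclength $s^{*}$ with Frenet frame $\widetilde T,\widetilde N,\widetilde B$. The pair $(\gamma,\widetilde\gamma)$ is a Bertrand pair if there is a correspondence of points such that the principal normals at corresponding points are linearly dependent, $N=\epsilon\widetilde N$ with $\epsilon=\pm1$, and $\widetilde\gamma(s^{*})=\gamma(s)+\lambda N(s)$ with $\lambda\neq0$ constant. Non-helical means that torsion/curvature of each curve is not constant, non-planar that the torsions are non-zero; it is assumed that $\widetilde\kappa'\neq0$, $\widetilde f\neq0$ and $\widetilde g\neq\widetilde f$ at each point. The tangent indicatrix of $\gamma$ is the curve $s\mapsto T(s)$ on the unit sphere.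 A spherical helix is a curve on the sphere which is a (general) helix, i.e. the ratio of its torsion to its curvature is constant. *)

(* Defs.v *)
(* Stdlib reals with Coquelicot. *)
From Stdlib Require Export Reals.
From Coquelicot Require Export Coquelicot.
Open Scope R_scope.

Definition vec3 : Type := (R * R * R)%type.

Definition cx (v : vec3) : R := fst (fst v).
Definition cy (v : vec3) : R := snd (fst v).
Definition cz (v : vec3) : R := snd v.

Definition dot (u v : vec3) : R := cx u * cx v + cy u * cy v + cz u * cz v.

Definition cross (u v : vec3) : vec3 :=
  (cy u * cz v - cz u * cy v, cz u * cx v - cx u * cz v, cx u * cy v - cy u * cx v).

Definition vnorm (v : vec3) : R := sqrt (dot v v).

(* Curves are total functions of which only the restriction to an open
   interval ]a, b[, possibly unbounded, matters. *)
Definition in_itv (a b : Rbar) (t : R) : Prop := Rbar_lt a t /\ Rbar_lt t b.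

Definition vDerive (F : R -> vec3) (t : R) : vec3 :=
  (Derive (fun u => cx (F u)) t,
   Derive (fun u => cy (F u)) t,
   Derive (fun u => cz (F u)) t).

Definition smooth_on (a b : Rbar) (F : R -> vec3) : Prop :=
  forall (n : nat) (t : R), in_itv a b t ->
    ex_derive_n (fun u => cx (F u)) n t /\
    ex_derive_n (fun u => cy (F u)) n t /\
    ex_derive_n (fun u => cz (F u)) n t.

Definition speed (c : R -> vec3) (t : R) : R := vnorm (vDerive c t).

(* Derivative of a vector field [F] along the regular curve [c] with respect to
   the arclength of [c], whatever the parameter of [c] is: d/ds = (1/|c'|) d/dt.
   The tangent indicatrix is not parameterized by its own arclength, so the
   Frenet apparatus is set up for arbitrary regular parameterizations. *)
Definition arcDerive (c F : R -> vec3) (t : R) : vec3 :=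
  scal (/ speed c t) (vDerive F t).

Definition tangent (c : R -> vec3) : R -> vec3 := arcDerive c c.

Definition curvature (c : R -> vec3) (t : R) : R :=
  vnorm (arcDerive c (tangent c) t).

Definition normal (c : R -> vec3) (t : R) : vec3 :=
  scal (/ curvature c t) (arcDerive c (tangent c) t).

Definition binormal (c : R -> vec3) (t : R) : vec3 :=
  cross (tangent c t) (normal c t).

(* Sign convention: dB/ds = - tau N. *)
Definition torsion (c : R -> vec3) (t : R) : R :=
  - dot (arcDerive c (binormal c) t) (normal c t).

Definition frenet_curve (a b : Rbar) (c : R -> vec3) : Prop :=
  smooth_on a b c /\
  (forall t, in_itv a b t -> speed c t <> 0) /\
  (forall t, in_itv a b t -> curvature c t <> 0).

Definition arclength_param (a b : Rbar) (c : R -> vec3) : Prop :=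
  forall t, in_itv a b t -> speed c t = 1.

Definition constant_ratio (a b : Rbar) (c : R -> vec3) : Prop :=
  exists k : R, forall t, in_itv a b t -> torsion c t / curvature c t = k.

Definition general_helix (a b : Rbar) (c : R -> vec3) : Prop :=
  frenet_curve a b c /\ constant_ratio a b c.

Definition spherical_helix (a b : Rbar) (c : R -> vec3) : Prop :=
  general_helix a b c /\ (forall t, in_itv a b t -> vnorm (c t) = 1).

Definition nonplanar (a b : Rbar) (c : R -> vec3) : Prop :=
  forall t, in_itv a b t -> torsion c t <> 0.

(* A continuous one-to-one correspondence between two open intervals; it may
   be increasing or decreasing. *)
Definition correspondence (a b a' b' : Rbar) (phi : R -> R) : Prop :=
  (forall s, in_itv a b s -> in_itv a' b' (phi s)) /\
  (forall t, in_itv a' b' t -> exists! s, in_itv a b s /\ phi s = t) /\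
  (forall s, in_itv a b s -> continuous phi s).

(* [g] and [g'] are parameterized by their own arclengths s and s*, and
   s* = phi s is the correspondence of points. *)
Definition bertrand_pair (a b a' b' : Rbar) (g g' : R -> vec3) : Prop :=
  frenet_curve a b g /\ arclength_param a b g /\
  frenet_curve a' b' g' /\ arclength_param a' b' g' /\
  exists (phi : R -> R) (lambda eps : R),
    correspondence a b a' b' phi /\
    lambda <> 0 /\
    (eps = 1 \/ eps = -1) /\
    (forall s, in_itv a b s -> normal g s = scal eps (normal g' (phi s))) /\
    (forall s, in_itv a b s ->
       g' (phi s) = plus (g s) (scal lambda (normal g s))).

(* Main.v *)
Require Import Defs.
From Stdlib Require Import Lra.

(* Let [T, N, B] be the frame of [gamma] and [q = ds*/ds]. Both [<T, T~>] and [<B, T~>] are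
   constant along a Bertrand pair, equal to [c] and [d] say, and comparing [gamma~'] with
   [(gamma + lambda N)'] expresses all four curvatures through [q] alone:
   [lambda kappa = 1 - c q], [lambda tau = d q], [lambda eps q kappa~ = c - q] and
   [lambda q tau~ = d]. The tangent indicatrix of [gamma] has torsion over curvature
   [(tau' kappa - kappa' tau) / (kappa^2 + tau^2)^(3/2)], and since [tau] is affine in [kappa]
   this is a nonzero constant times [kappa' / (kappa^2 + tau^2)^(3/2)]. It is constant iff its
   derivative vanishes, which turns out to be the stated equation up to a nonvanishing factor. *)

(** * Vectors in R^3 *)

Lemma vec3_ext (u v : vec3) : cx u = cx v -> cy u = cy v -> cz u = cz v -> u = v.
Proof.
destruct u as [[u1 u2] u3], v as [[v1 v2] v3]; unfold cx, cy, cz; simpl.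
now intros -> -> ->.
Qed.

Lemma cx_plus (u v : vec3) : cx (plus u v) = cx u + cx v. Proof. reflexivity. Qed.
Lemma cy_plus (u v : vec3) : cy (plus u v) = cy u + cy v. Proof. reflexivity. Qed.
Lemma cz_plus (u v : vec3) : cz (plus u v) = cz u + cz v. Proof. reflexivity. Qed.
Lemma cx_scal (k : R) (u : vec3) : cx (scal k u) = k * cx u. Proof. reflexivity. Qed.
Lemma cy_scal (k : R) (u : vec3) : cy (scal k u) = k * cy u. Proof. reflexivity. Qed.
Lemma cz_scal (k : R) (u : vec3) : cz (scal k u) = k * cz u. Proof. reflexivity. Qed.
Lemma cx_cross (u v : vec3) : cx (cross u v) = cy u * cz v - cz u * cy v.
Proof. reflexivity. Qed.
Lemma cy_cross (u v : vec3) : cy (cross u v) = cz u * cx v - cx u * cz v.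
Proof. reflexivity. Qed.
Lemma cz_cross (u v : vec3) : cz (cross u v) = cx u * cy v - cy u * cx v.
Proof. reflexivity. Qed.

#[local] Hint Rewrite cx_plus cy_plus cz_plus cx_scal cy_scal cz_scal
  cx_cross cy_cross cz_cross : coord.

Ltac dot_ring := intros; unfold dot; autorewrite with coord; ring.
Ltac vec_ring := intros; apply vec3_ext; unfold dot; autorewrite with coord; ring.

Lemma dot_sym (u v : vec3) : dot u v = dot v u. Proof. dot_ring. Qed.
Lemma dot_plus_l (u v w : vec3) : dot (plus u v) w = dot u w + dot v w.
Proof. dot_ring. Qed.
Lemma dot_plus_r (u v w : vec3) : dot w (plus u v) = dot w u + dot w v.
Proof. dot_ring. Qed.
Lemma dot_scal_l (k : R) (u v : vec3) : dot (scal k u) v = k * dot u v.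
Proof. dot_ring. Qed.
Lemma dot_scal_r (k : R) (u v : vec3) : dot u (scal k v) = k * dot u v.
Proof. dot_ring. Qed.

#[local] Hint Rewrite dot_plus_l dot_plus_r dot_scal_l dot_scal_r : dotlin.

Lemma dot_cross_l (u v : vec3) : dot u (cross u v) = 0. Proof. dot_ring. Qed.
Lemma dot_cross_r (u v : vec3) : dot v (cross u v) = 0. Proof. dot_ring. Qed.
Lemma cross_cross_l (u v w : vec3) :
  cross (cross u v) w = plus (scal (dot u w) v) (scal (- dot v w) u).
Proof. vec_ring. Qed.
Lemma cross_cross_r (u v w : vec3) :
  cross u (cross v w) = plus (scal (dot u w) v) (scal (- dot u v) w).
Proof. vec_ring. Qed.
Lemma cross_plus_l (u v w : vec3) : cross (plus u v) w = plus (cross u w) (cross v w).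
Proof. vec_ring. Qed.
Lemma cross_plus_r (u v w : vec3) : cross w (plus u v) = plus (cross w u) (cross w v).
Proof. vec_ring. Qed.
Lemma cross_scal_l (k : R) (u v : vec3) : cross (scal k u) v = scal k (cross u v).
Proof. vec_ring. Qed.
Lemma cross_scal_r (k : R) (u v : vec3) : cross u (scal k v) = scal k (cross u v).
Proof. vec_ring. Qed.
Lemma dot_cross_cross (u v : vec3) :
  dot (cross u v) (cross u v) = dot u u * dot v v - dot u v ^ 2.
Proof. dot_ring. Qed.

Lemma dot_self_ge0 (u : vec3) : 0 <= dot u u.
Proof. unfold dot; nra. Qed.

(** A sum of three squares vanishes only termwise. The difference is written with [plus] and [scal],
    the operations that the rewrite bases handle. *)
Lemma dot_self_eq0 (u v : vec3) :
  dot (plus u (scal (-1) v)) (plus u (scal (-1) v)) = 0 -> u = v.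
Proof.
unfold dot; autorewrite with coord; intros H.
assert (L : forall x y z : R, x * x + y * y + z * z = 0 -> x = 0 /\ y = 0 /\ z = 0)
  by (intros; repeat split; nra).
apply L in H; apply vec3_ext; lra.
Qed.

Lemma vnorm_sqr (u : vec3) : vnorm u * vnorm u = dot u u.
Proof. apply sqrt_sqrt, dot_self_ge0. Qed.

(** The remainder after subtracting the three projections is orthogonal to [T], [N] and [cross T N],
    hence zero. This gives the frame coordinates of [N'] and of the tangent of the mate. *)
Lemma orthonormal_expand (T N v : vec3) :
  dot T T = 1 -> dot N N = 1 -> dot T N = 0 ->
  v = plus (plus (scal (dot v T) T) (scal (dot v N) N))
           (scal (dot v (cross T N)) (cross T N)).
Proof.
intros HT HN HTN.
assert (HB : dot (cross T N) (cross T N) = 1) by (rewrite dot_cross_cross; nra).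
set (B := cross T N) in *.
assert (HTB : dot T B = 0) by apply dot_cross_l.
assert (HNB : dot N B = 0) by apply dot_cross_r.
apply dot_self_eq0.
set (w := plus v _).
assert (wT : dot w T = 0).
{ unfold w; autorewrite with dotlin.
  rewrite (dot_sym N T), (dot_sym B T), HT, HTN, HTB; ring. }
assert (wN : dot w N = 0).
{ unfold w; autorewrite with dotlin.
  rewrite (dot_sym B N), HN, HTN, HNB; ring. }
assert (wB : dot w B = 0).
{ unfold w; autorewrite with dotlin.
  rewrite HB, HTB, HNB; ring. }
(* [w x B = 0] by the triple product, so Lagrange gives [|w|^2 |B|^2 = (w . B)^2]. *)
assert (E : cross w B = scal 0 B).
{ unfold B; rewrite cross_cross_r; rewrite wT, wN; vec_ring. }
assert (L := dot_cross_cross w B).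
rewrite E, wB, HB in L; autorewrite with dotlin in L.
lra.
Qed.

(** * Derivatives on open intervals *)

(** Lets the differentiation rules produce a value in their own form, to be matched afterwards by
    algebra. *)
Lemma is_derive_eq (f : R -> R) (t k l : R) : is_derive f t k -> k = l -> is_derive f t l.
Proof. now intros H <-. Qed.

Lemma is_derive_mulR (f g : R -> R) (t f' g' : R) :
  is_derive f t f' -> is_derive g t g' ->
  is_derive (fun u => f u * g u) t (f' * g t + f t * g').
Proof.
intros Hf Hg; apply is_derive_Reals.
apply (derivable_pt_lim_mult f g); now apply is_derive_Reals.
Qed.

Lemma is_derive_addR (f g : R -> R) (t f' g' : R) :
  is_derive f t f' -> is_derive g t g' -> is_derive (fun u => f u + g u) t (f' + g').
Proof. intros Hf Hg; exact (is_derive_plus f g t f' g' Hf Hg). Qed.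

Lemma is_derive_subR (f g : R -> R) (t f' g' : R) :
  is_derive f t f' -> is_derive g t g' -> is_derive (fun u => f u - g u) t (f' - g').
Proof. intros Hf Hg; exact (is_derive_minus f g t f' g' Hf Hg). Qed.

Lemma is_derive_uniq (f : R -> R) (t k l : R) : is_derive f t k -> is_derive f t l -> k = l.
Proof.
intros H1 H2; rewrite <- (is_derive_unique _ _ _ H1); now apply is_derive_unique.
Qed.

(** Relational counterpart of [vDerive]: it also carries differentiability, whereas [vDerive] has a
    value at every point. *)
Definition is_vderive (F : R -> vec3) (t : R) (v : vec3) : Prop :=
  is_derive (fun u => cx (F u)) t (cx v) /\
  is_derive (fun u => cy (F u)) t (cy v) /\
  is_derive (fun u => cz (F u)) t (cz v).

Lemma is_vderive_eq (F : R -> vec3) (t : R) (v w : vec3) :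
  is_vderive F t v -> v = w -> is_vderive F t w.
Proof. now intros H <-. Qed.

Lemma is_vderive_unique (F : R -> vec3) (t : R) (v : vec3) :
  is_vderive F t v -> vDerive F t = v.
Proof.
intros (Hx & Hy & Hz); apply vec3_ext; now apply is_derive_unique.
Qed.

Lemma is_vderive_ext_loc (F G : R -> vec3) (t : R) (v : vec3) :
  locally t (fun u => F u = G u) -> is_vderive F t v -> is_vderive G t v.
Proof.
intros HFG (Hx & Hy & Hz); repeat split;
  (eapply is_derive_ext_loc; [|eassumption]);
  apply filter_imp with (2 := HFG); now intros u ->.
Qed.

Lemma is_derive_dot (F G : R -> vec3) (t : R) (v w : vec3) :
  is_vderive F t v -> is_vderive G t w ->
  is_derive (fun u => dot (F u) (G u)) t (dot v (G t) + dot (F t) w).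
Proof.
intros (Fx & Fy & Fz) (Gx & Gy & Gz).
eapply is_derive_eq.
{ apply is_derive_addR; [apply is_derive_addR|];
    apply is_derive_mulR; eassumption. }
dot_ring.
Qed.

Lemma is_vderive_cross (F G : R -> vec3) (t : R) (v w : vec3) :
  is_vderive F t v -> is_vderive G t w ->
  is_vderive (fun u => cross (F u) (G u)) t (plus (cross v (G t)) (cross (F t) w)).
Proof.
intros (Fx & Fy & Fz) (Gx & Gy & Gz).
split; [|split].
- apply is_derive_eq with (cy v * cz (G t) + cy (F t) * cz w - (cz v * cy (G t) + cz (F t) * cy w)).
  + apply (is_derive_subR (fun u => cy (F u) * cz (G u)) (fun u => cz (F u) * cy (G u)));
      now apply is_derive_mulR.
  + autorewrite with coord; ring.
- apply is_derive_eq with (cz v * cx (G t) + cz (F t) * cx w - (cx v * cz (G t) + cx (F t) * cz w)).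
  + apply (is_derive_subR (fun u => cz (F u) * cx (G u)) (fun u => cx (F u) * cz (G u)));
      now apply is_derive_mulR.
  + autorewrite with coord; ring.
- apply is_derive_eq with (cx v * cy (G t) + cx (F t) * cy w - (cy v * cx (G t) + cy (F t) * cx w)).
  + apply (is_derive_subR (fun u => cx (F u) * cy (G u)) (fun u => cy (F u) * cx (G u)));
      now apply is_derive_mulR.
  + autorewrite with coord; ring.
Qed.

Lemma is_vderive_plus (F G : R -> vec3) (t : R) (v w : vec3) :
  is_vderive F t v -> is_vderive G t w ->
  is_vderive (fun u => plus (F u) (G u)) t (plus v w).
Proof.
intros (Fx & Fy & Fz) (Gx & Gy & Gz).
(split; [|split]); now apply is_derive_addR.
Qed.

Lemma is_vderive_scal (f : R -> R) (F : R -> vec3) (t k : R) (v : vec3) :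
  is_derive f t k -> is_vderive F t v ->
  is_vderive (fun u => scal (f u) (F u)) t (plus (scal k (F t)) (scal (f t) v)).
Proof.
intros Hf (Fx & Fy & Fz).
(split; [|split]); now apply is_derive_mulR.
Qed.

(** The zero vector takes the form [scal 0 v], so that linearity of [dot] removes it. *)
Lemma is_vderive_const (v : vec3) (t : R) : is_vderive (fun _ => v) t (scal 0 v).
Proof.
(split; [|split]); (eapply is_derive_eq; [apply is_derive_const|]);
  autorewrite with coord; rewrite Rmult_0_l; reflexivity.
Qed.

Lemma is_vderive_comp (F : R -> vec3) (h : R -> R) (t k : R) (v : vec3) :
  is_vderive F (h t) v -> is_derive h t k ->
  is_vderive (fun u => F (h u)) t (scal k v).
Proof.
intros (Fx & Fy & Fz) Hh.
split; [|split].
- exact (is_derive_comp (fun u => cx (F u)) h t _ _ Fx Hh).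
- exact (is_derive_comp (fun u => cy (F u)) h t _ _ Fy Hh).
- exact (is_derive_comp (fun u => cz (F u)) h t _ _ Fz Hh).
Qed.

Lemma in_itv_locally (a b : Rbar) (t : R) :
  in_itv a b t -> locally t (in_itv a b).
Proof.
intros [Ha Hb]; apply filter_and.
- exact (open_Rbar_gt' t a Ha).
- exact (open_Rbar_lt' t b Hb).
Qed.

Lemma in_itv_convex (a b : Rbar) (s t u : R) :
  in_itv a b s -> in_itv a b t -> s <= u <= t -> in_itv a b u.
Proof.
intros [Ha _] [_ Hb] [Hs Ht]; split.
- now apply Rbar_lt_le_trans with s.
- now apply Rbar_le_lt_trans with t.
Qed.

Lemma in_itv_inhabited (a b : Rbar) : Rbar_lt a b -> exists t, in_itv a b t.
Proof.
unfold in_itv; destruct a as [a| |], b as [b| |]; simpl; try easy; intros H.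
- exists ((a + b) / 2); lra.
- exists (a + 1); lra.
- exists (b - 1); lra.
- now exists 0.
Qed.

(** Identities along a curve hold only on its interval. As the interval is open, they hold near each
    of its points and may be differentiated. *)
Lemma is_derive_ext_itv (a b : Rbar) (f g : R -> R) (t l : R) :
  in_itv a b t -> (forall u, in_itv a b u -> f u = g u) ->
  is_derive f t l -> is_derive g t l.
Proof.
intros Ht H; apply is_derive_ext_loc.
apply filter_imp with (2 := in_itv_locally _ _ _ Ht); exact H.
Qed.

Lemma is_vderive_ext_itv (a b : Rbar) (F G : R -> vec3) (t : R) (v : vec3) :
  in_itv a b t -> (forall u, in_itv a b u -> F u = G u) ->
  is_vderive F t v -> is_vderive G t v.
Proof.
intros Ht H; apply is_vderive_ext_loc.
apply filter_imp with (2 := in_itv_locally _ _ _ Ht); exact H.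
Qed.

Lemma constant_on_itv (a b : Rbar) (f : R -> R) :
  (forall t, in_itv a b t -> is_derive f t 0) ->
  forall s t, in_itv a b s -> in_itv a b t -> f s = f t.
Proof.
intros Hf.
assert (H : forall s t, s < t -> in_itv a b s -> in_itv a b t -> f s = f t).
{ intros s t Hst Hs Ht; apply eq_is_derive; [|exact Hst].
  intros u Hu; apply Hf; exact (in_itv_convex _ _ _ _ _ Hs Ht Hu). }
intros s t Hs Ht; destruct (Rtotal_order s t) as [L|[E|L]].
- now apply H.
- now rewrite E.
- symmetry; now apply H.
Qed.

(** * Frenet equations *)

(** At unit speed the tangent is [jet c 1] and the curvature vector [jet c 2], so regularity of the
    frame comes down to that of the coordinates. *)
Definition jet (c : R -> vec3) (n : nat) (t : R) : vec3 :=
  (Derive_n (fun u => cx (c u)) n t,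
   Derive_n (fun u => cy (c u)) n t,
   Derive_n (fun u => cz (c u)) n t).

(** By definition, [ex_derive_n] at order [S n] is differentiability of [Derive_n] at order [n]. *)
Lemma is_vderive_jet (a b : Rbar) (c : R -> vec3) (n : nat) (t : R) :
  smooth_on a b c -> in_itv a b t -> is_vderive (jet c n) t (jet c (S n) t).
Proof.
intros Hc Ht; destruct (Hc (S n) t Ht) as (Hx & Hy & Hz).
(split; [|split]); apply Derive_correct; assumption.
Qed.

Lemma is_vderive_curve (a b : Rbar) (c : R -> vec3) (t : R) :
  smooth_on a b c -> in_itv a b t -> is_vderive c t (jet c 1 t).
Proof. exact (is_vderive_jet a b c 0 t). Qed.

Section ArclengthCurve.

Variables (a b : Rbar) (c : R -> vec3).
Hypotheses (Hc : frenet_curve a b c) (Harc : arclength_param a b c).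

Lemma arcDerive_arclength (F : R -> vec3) (t : R) :
  in_itv a b t -> arcDerive c F t = vDerive F t.
Proof.
intros Ht; unfold arcDerive; rewrite (Harc t Ht), Rinv_1.
exact (scal_one _).
Qed.

Lemma tangent_jet (t : R) : in_itv a b t -> tangent c t = jet c 1 t.
Proof. intros Ht; unfold tangent; now rewrite arcDerive_arclength. Qed.

Lemma is_vderive_tangent_jet (t : R) :
  in_itv a b t -> is_vderive (tangent c) t (jet c 2 t).
Proof.
intros Ht; apply (is_vderive_ext_itv a b (jet c 1)); [exact Ht| |].
- intros u Hu; symmetry; now apply tangent_jet.
- now apply (is_vderive_jet a b); [apply Hc|].
Qed.

Lemma arcDerive_tangent_jet (t : R) :
  in_itv a b t -> arcDerive c (tangent c) t = jet c 2 t.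
Proof.
intros Ht; rewrite arcDerive_arclength by exact Ht.
now apply is_vderive_unique, is_vderive_tangent_jet.
Qed.

Lemma curvature_jet (t : R) : in_itv a b t -> curvature c t = vnorm (jet c 2 t).
Proof. intros Ht; unfold curvature; now rewrite arcDerive_tangent_jet. Qed.

Lemma normal_jet (t : R) :
  in_itv a b t -> normal c t = scal (/ curvature c t) (jet c 2 t).
Proof. intros Ht; unfold normal; now rewrite arcDerive_tangent_jet. Qed.

Lemma curvature_gt0 (t : R) : in_itv a b t -> 0 < curvature c t.
Proof.
intros Ht; assert (H := proj2 (proj2 Hc) t Ht).
assert (0 <= curvature c t) by apply sqrt_pos.
lra.
Qed.

Lemma curvature_sqr (t : R) :
  in_itv a b t -> curvature c t * curvature c t = dot (jet c 2 t) (jet c 2 t).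
Proof. intros Ht; rewrite curvature_jet by exact Ht; apply vnorm_sqr. Qed.

(** The curvature is the norm of the nonvanishing vector [jet c 2], and the square root is smooth
    away from 0. The derivatives are existential because later formulas treat them as the symbols
    [k1] and [k2]. *)
Lemma curvature_derive2 :
  exists k1 k2 : R -> R, forall t, in_itv a b t ->
    is_derive (curvature c) t (k1 t) /\ is_derive k1 t (k2 t).
Proof.
set (J := jet c).
assert (HJ : forall n t, in_itv a b t -> is_vderive (J n) t (J (S n) t)).
{ intros n t Ht; apply (is_vderive_jet a b); [apply Hc|exact Ht]. }
set (k1 := fun t => dot (J 2%nat t) (J 3%nat t) / curvature c t).
assert (H1 : forall t, in_itv a b t -> is_derive (curvature c) t (k1 t)).
{ intros t Ht; assert (Hk := curvature_gt0 t Ht).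
  apply (is_derive_ext_itv a b (fun u => sqrt (dot (J 2%nat u) (J 2%nat u)))).
  - exact Ht.
  - intros u Hu; symmetry; now apply curvature_jet.
  - eapply is_derive_eq.
    + apply is_derive_sqrt; [apply is_derive_dot; now apply HJ|].
      unfold J; rewrite <- curvature_sqr by exact Ht; nra.
    + unfold k1; rewrite curvature_jet by exact Ht.
      rewrite (dot_sym (J 3%nat t)).
      rewrite curvature_jet in Hk by exact Ht.
      unfold vnorm in *; fold J in Hk |- *; field; lra. }
exists k1.
(* The hole may depend on [t]; the quotient rule applied to [k1] fills it. *)
eexists (fun t => _); intros t Ht; split; [now apply H1|].
assert (Hk := curvature_gt0 t Ht).
apply is_derive_div; [apply is_derive_dot; now apply HJ|now apply H1|lra].
Qed.

Lemma dot_tangent_self (t : R) : in_itv a b t -> dot (tangent c t) (tangent c t) = 1.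
Proof.
intros Ht; rewrite tangent_jet by exact Ht.
rewrite <- vnorm_sqr; change (vnorm (jet c 1 t)) with (speed c t).
rewrite Harc by exact Ht; ring.
Qed.

Lemma is_vderive_curve_tangent (t : R) : in_itv a b t -> is_vderive c t (tangent c t).
Proof.
intros Ht; rewrite tangent_jet by exact Ht.
now apply (is_vderive_curve a b); [apply Hc|].
Qed.

Lemma is_vderive_tangent (t : R) :
  in_itv a b t -> is_vderive (tangent c) t (scal (curvature c t) (normal c t)).
Proof.
intros Ht; assert (Hk := curvature_gt0 t Ht).
eapply is_vderive_eq; [now apply is_vderive_tangent_jet|].
rewrite normal_jet by exact Ht.
apply vec3_ext; autorewrite with coord; field; lra.
Qed.

Lemma dot_normal_self (t : R) : in_itv a b t -> dot (normal c t) (normal c t) = 1.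
Proof.
intros Ht; assert (Hk := curvature_gt0 t Ht).
rewrite normal_jet by exact Ht; autorewrite with dotlin.
rewrite <- curvature_sqr by exact Ht; field; lra.
Qed.

(** Differentiating [<T, T> = 1] gives [2 kappa <T, N> = 0], and [kappa] is positive. *)
Lemma dot_tangent_normal (t : R) : in_itv a b t -> dot (tangent c t) (normal c t) = 0.
Proof.
intros Ht; assert (Hk := curvature_gt0 t Ht).
assert (H := is_derive_dot _ _ _ _ _ (is_vderive_tangent t Ht) (is_vderive_tangent t Ht)).
assert (H0 : is_derive (fun u => dot (tangent c u) (tangent c u)) t 0).
{ apply (is_derive_ext_itv a b (fun _ => 1)); [exact Ht| |apply (is_derive_const 1 t)].
  intros u Hu; symmetry; now apply dot_tangent_self. }
assert (E := is_derive_uniq _ _ _ _ H H0).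
rewrite dot_scal_l, dot_scal_r, (dot_sym (normal c t)) in E.
nra.
Qed.

Lemma dot_binormal_self (t : R) : in_itv a b t -> dot (binormal c t) (binormal c t) = 1.
Proof.
intros Ht; unfold binormal; rewrite dot_cross_cross.
rewrite dot_tangent_self, dot_normal_self, dot_tangent_normal by exact Ht; ring.
Qed.

(** [N] is differentiable as the quotient of [jet c 2] by the curvature. The coordinates of [N']
    along [T] and [N] come from differentiating [<N, T> = 0] and [<N, N> = 1]; the one along [B] is
    the torsion. *)
Lemma is_vderive_normal (t : R) :
  in_itv a b t ->
  is_vderive (normal c) t
    (plus (scal (- curvature c t) (tangent c t)) (scal (torsion c t) (binormal c t))).
Proof.
intros Ht; assert (Hk := curvature_gt0 t Ht).
destruct curvature_derive2 as (k1 & k2 & Hk12).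
assert (HN : exists v, is_vderive (normal c) t v).
{ eexists; apply (is_vderive_ext_itv a b (fun u => scal (/ curvature c u) (jet c 2 u))).
  - exact Ht.
  - intros u Hu; symmetry; now apply normal_jet.
  - apply is_vderive_scal.
    + apply (is_derive_inv _ _ _ (proj1 (Hk12 t Ht))); lra.
    + apply (is_vderive_jet a b); [apply Hc|exact Ht]. }
destruct HN as [v Hv].
assert (TT := dot_tangent_self t Ht).
assert (NN := dot_normal_self t Ht).
assert (TN := dot_tangent_normal t Ht).
assert (dT := is_vderive_tangent t Ht).
assert (vT : dot v (tangent c t) = - curvature c t).
{ assert (H := is_derive_dot _ _ _ _ _ Hv dT).
  assert (H0 : is_derive (fun u => dot (normal c u) (tangent c u)) t 0).
  { apply (is_derive_ext_itv a b (fun _ => 0)); [exact Ht| |apply (is_derive_const 0 t)].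
    intros u Hu; rewrite dot_sym; symmetry; now apply dot_tangent_normal. }
  assert (E := is_derive_uniq _ _ _ _ H H0).
  rewrite dot_scal_r, NN in E; lra. }
assert (vN : dot v (normal c t) = 0).
{ assert (H := is_derive_dot _ _ _ _ _ Hv Hv).
  assert (H0 : is_derive (fun u => dot (normal c u) (normal c u)) t 0).
  { apply (is_derive_ext_itv a b (fun _ => 1)); [exact Ht| |apply (is_derive_const 1 t)].
    intros u Hu; symmetry; now apply dot_normal_self. }
  assert (E := is_derive_uniq _ _ _ _ H H0).
  rewrite (dot_sym (normal c t)) in E; lra. }
(* Here [B' = kappa N x N + T x v = T x v], and the triple product turns [- <T x v, N>] into
   [<v, T x N>]. *)
assert (vB : dot v (binormal c t) = torsion c t).
{ unfold torsion; rewrite arcDerive_arclength by exact Ht.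
  rewrite (is_vderive_unique (binormal c) _ _ (is_vderive_cross _ _ _ _ _ dT Hv)).
  unfold binormal, dot; autorewrite with coord; ring. }
eapply is_vderive_eq; [exact Hv|].
rewrite (orthonormal_expand _ _ v TT NN TN) at 1.
fold (binormal c t); rewrite vT, vN, vB; vec_ring.
Qed.

Lemma cross_normal_binormal (t : R) :
  in_itv a b t -> cross (normal c t) (binormal c t) = tangent c t.
Proof.
intros Ht; unfold binormal; rewrite cross_cross_r.
rewrite dot_normal_self, (dot_sym (normal c t)), dot_tangent_normal by exact Ht; vec_ring.
Qed.

(** Differentiating [T x N] leaves only [tau T x B], which is [- tau N]. *)
Lemma is_vderive_binormal (t : R) :
  in_itv a b t -> is_vderive (binormal c) t (scal (- torsion c t) (normal c t)).
Proof.
intros Ht; eapply is_vderive_eq.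
{ apply is_vderive_cross; [now apply is_vderive_tangent|now apply is_vderive_normal]. }
rewrite cross_plus_r, !cross_scal_r, cross_scal_l.
unfold binormal at 1; rewrite cross_cross_r.
rewrite dot_tangent_normal, dot_tangent_self by exact Ht; vec_ring.
Qed.

End ArclengthCurve.

(** * Tangent indicatrix *)

Lemma vnorm_eq (u : vec3) (x : R) : 0 <= x -> dot u u = x * x -> vnorm u = x.
Proof. intros Hx E; unfold vnorm; rewrite E; now apply sqrt_square. Qed.

Section TangentIndicatrix.

Variables (a b : Rbar) (c : R -> vec3).
Hypotheses (Hc : frenet_curve a b c) (Harc : arclength_param a b c).

Let k := curvature c.
Let tau := torsion c.
(** The length of the Darboux vector [tau T + kappa B]. *)
Let w (t : R) := sqrt (k t * k t + tau t * tau t).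

Lemma darboux_gt0 (t : R) : in_itv a b t -> 0 < w t.
Proof.
intros Ht; assert (Hk := curvature_gt0 _ _ _ Hc t Ht).
apply sqrt_lt_R0; unfold k; nra.
Qed.

Lemma darboux_sqr (t : R) : w t * w t = k t * k t + tau t * tau t.
Proof. apply sqrt_sqrt; nra. Qed.

Lemma speed_indicatrix (t : R) : in_itv a b t -> speed (tangent c) t = k t.
Proof.
intros Ht; unfold speed.
rewrite (is_vderive_unique _ _ _ (is_vderive_tangent _ _ _ Hc Harc t Ht)).
apply vnorm_eq.
- left; exact (curvature_gt0 _ _ _ Hc t Ht).
- rewrite dot_scal_l, dot_scal_r, (dot_normal_self a b) by assumption; fold k; ring.
Qed.

Lemma tangent_indicatrix (t : R) : in_itv a b t -> tangent (tangent c) t = normal c t.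
Proof.
intros Ht; assert (Hk := curvature_gt0 _ _ _ Hc t Ht).
unfold tangent at 1, arcDerive; rewrite speed_indicatrix by exact Ht.
rewrite (is_vderive_unique _ _ _ (is_vderive_tangent _ _ _ Hc Harc t Ht)).
unfold k; apply vec3_ext; autorewrite with coord; field; lra.
Qed.

Lemma arcDerive_tangent_indicatrix (t : R) :
  in_itv a b t ->
  arcDerive (tangent c) (tangent (tangent c)) t =
  scal (/ k t) (plus (scal (- k t) (tangent c t)) (scal (tau t) (binormal c t))).
Proof.
intros Ht; unfold arcDerive; rewrite speed_indicatrix by exact Ht.
f_equal; apply is_vderive_unique.
apply (is_vderive_ext_itv a b (normal c)); [exact Ht| |].
- intros u Hu; symmetry; now apply tangent_indicatrix.
- exact (is_vderive_normal _ _ _ Hc Harc t Ht).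
Qed.

Lemma curvature_indicatrix (t : R) :
  in_itv a b t -> curvature (tangent c) t = w t / k t.
Proof.
intros Ht; assert (Hk := curvature_gt0 _ _ _ Hc t Ht).
assert (Hw := darboux_gt0 t Ht); fold k in Hk.
unfold curvature at 1; rewrite arcDerive_tangent_indicatrix by exact Ht.
apply vnorm_eq; [left; now apply Rdiv_lt_0_compat|].
replace (w t / k t * (w t / k t)) with (w t * w t / (k t * k t)) by (field; lra).
rewrite darboux_sqr; autorewrite with dotlin.
rewrite (dot_sym (binormal c t) (tangent c t)).
replace (dot (tangent c t) (binormal c t)) with 0 by (symmetry; apply dot_cross_l).
rewrite (dot_tangent_self a b), (dot_binormal_self a b) by assumption; field; lra.
Qed.

Lemma normal_indicatrix (t : R) :
  in_itv a b t ->
  normal (tangent c) t =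
  scal (/ w t) (plus (scal (- k t) (tangent c t)) (scal (tau t) (binormal c t))).
Proof.
intros Ht; assert (Hk := curvature_gt0 _ _ _ Hc t Ht).
assert (Hw := darboux_gt0 t Ht); fold k in Hk.
unfold normal; rewrite arcDerive_tangent_indicatrix, curvature_indicatrix by exact Ht.
apply vec3_ext; autorewrite with coord; field; lra.
Qed.

(** This is the unit Darboux vector: the indicatrix has tangent [N], and [N x T = - B],
    [N x B = T]. *)
Lemma binormal_indicatrix (t : R) :
  in_itv a b t ->
  binormal (tangent c) t =
  plus (scal (k t / w t) (binormal c t)) (scal (tau t / w t) (tangent c t)).
Proof.
intros Ht; unfold binormal at 1.
rewrite tangent_indicatrix, normal_indicatrix by exact Ht.
rewrite cross_scal_r, cross_plus_r, !cross_scal_r.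
rewrite (cross_normal_binormal a b) by assumption.
assert (E : cross (normal c t) (tangent c t) = scal (-1) (binormal c t))
  by (unfold binormal; vec_ring).
rewrite E; unfold Rdiv; vec_ring.
Qed.

(** In the derivative of the unit Darboux vector the [N] terms cancel, leaving
    [(k/w)' B + (tau/w)' T]. Its product with the normal [(- k T + tau B) / w] is
    [(k' tau - tau' k) / w^2]; the sign convention and the speed [k] do the rest. *)
Lemma torsion_indicatrix (t k' tau' : R) :
  in_itv a b t -> is_derive k t k' -> is_derive tau t tau' ->
  torsion (tangent c) t = (tau' * k t - k' * tau t) / (k t * (w t * w t)).
Proof.
intros Ht dk dtau; assert (Hk := curvature_gt0 _ _ _ Hc t Ht).
assert (Hw := darboux_gt0 t Ht); fold k in Hk.
(* The value of [w'] stays abstract: it cancels in the final [field]. *)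
assert (dw : exists w', is_derive w t w').
{ eexists; apply is_derive_sqrt.
  - apply is_derive_addR; apply is_derive_mulR; eassumption.
  - nra. }
destruct dw as [w' dw].
assert (w0 : w t <> 0) by lra.
assert (dk1 := is_derive_div _ _ _ _ _ dk dw w0).
assert (dtau1 := is_derive_div _ _ _ _ _ dtau dw w0).
assert (dT := is_vderive_tangent _ _ _ Hc Harc t Ht).
assert (dB := is_vderive_binormal _ _ _ Hc Harc t Ht).
assert (D := is_vderive_plus _ _ _ _ _ (is_vderive_scal _ _ _ _ _ dk1 dB)
                                        (is_vderive_scal _ _ _ _ _ dtau1 dT)).
assert (D1 := is_vderive_ext_itv a b _ (binormal (tangent c)) t _ Ht
  (fun u Hu => eq_sym (binormal_indicatrix u Hu)) D).
unfold torsion at 1, arcDerive.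
rewrite (is_vderive_unique _ _ _ D1), speed_indicatrix, normal_indicatrix by exact Ht.
fold k tau; autorewrite with dotlin.
assert (TB : dot (tangent c t) (binormal c t) = 0) by apply dot_cross_l.
assert (NB : dot (normal c t) (binormal c t) = 0) by apply dot_cross_r.
rewrite (dot_sym (binormal c t) (tangent c t)), (dot_sym (normal c t) (tangent c t)).
rewrite (dot_tangent_self a b), (dot_binormal_self a b), (dot_tangent_normal a b), TB, NB
  by assumption.
field; lra.
Qed.

(** On the interval the coordinates of [T] are derivatives of those of [c], hence smooth; the speed
    [k] and the curvature [w / k] are positive. *)
Lemma frenet_curve_indicatrix : frenet_curve a b (tangent c).
Proof.
split; [|split].
(* Order [n] of [Derive f] is order [S n] of [f]; order 0 is trivial since [ex_derive_n] is then
   [True]. *)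
- assert (D : forall f n t, (forall m u, in_itv a b u -> ex_derive_n f m u) ->
                in_itv a b t -> ex_derive_n (Derive f) n t).
  { intros f [|n] t Hf Ht; [exact I|].
    apply ex_derive_ext with (2 := Hf (S (S n)) t Ht).
    intros u; rewrite <- (Nat.add_1_r n), <- Derive_n_comp; reflexivity. }
  assert (L : forall t, in_itv a b t -> locally t (fun u => jet c 1 u = tangent c u)).
  { intros t Ht; apply filter_imp with (2 := in_itv_locally _ _ _ Ht).
    intros u Hu; symmetry; now apply (tangent_jet a b). }
  intros n t Ht; split; [|split].
  + apply ex_derive_n_ext_loc with (fun u => cx (jet c 1 u)).
    * apply filter_imp with (2 := L t Ht); now intros u ->.
    * apply (D (fun u => cx (c u))); [|exact Ht]; intros m u Hu; now apply Hc.
  + apply ex_derive_n_ext_loc with (fun u => cy (jet c 1 u)).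
    * apply filter_imp with (2 := L t Ht); now intros u ->.
    * apply (D (fun u => cy (c u))); [|exact Ht]; intros m u Hu; now apply Hc.
  + apply ex_derive_n_ext_loc with (fun u => cz (jet c 1 u)).
    * apply filter_imp with (2 := L t Ht); now intros u ->.
    * apply (D (fun u => cz (c u))); [|exact Ht]; intros m u Hu; now apply Hc.
- intros t Ht; rewrite speed_indicatrix by exact Ht.
  assert (Hk := curvature_gt0 _ _ _ Hc t Ht); unfold k; lra.
- intros t Ht; rewrite curvature_indicatrix by exact Ht.
  assert (0 < w t / k t); [|lra].
  apply Rdiv_lt_0_compat; [now apply darboux_gt0|exact (curvature_gt0 _ _ _ Hc t Ht)].
Qed.

(** The indicatrix always is a Frenet curve on the unit sphere, so being a spherical helix reduces
    to the constancy of one ratio. *)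
Lemma spherical_helix_indicatrix :
  spherical_helix a b (tangent c) <-> constant_ratio a b (tangent c).
Proof.
split; [now intros [[_ H] _]|].
intros H; split; [split; [exact frenet_curve_indicatrix|exact H]|].
intros t Ht; apply vnorm_eq; [lra|].
rewrite (dot_tangent_self a b) by assumption; ring.
Qed.

(** For [tau = A - m k] the numerator [tau' k - k' tau] collapses to [- A k'], so the ratio is
    [- A k' / w^3]. Its derivative is [- A / w^5] times the expression on the right, and
    [A <> 0]. *)
Lemma indicatrix_helix_iff (A m : R) (k1 k2 : R -> R) :
  A <> 0 ->
  (forall t, in_itv a b t -> tau t = A - m * k t) ->
  (forall t, in_itv a b t -> is_derive k t (k1 t)) ->
  (forall t, in_itv a b t -> is_derive k1 t (k2 t)) ->
  spherical_helix a b (tangent c) <->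
  forall t, in_itv a b t ->
    k2 t * (k t ^ 2 + tau t ^ 2) - 3 * k1 t ^ 2 * (k t - m * tau t) = 0.
Proof.
intros HA Htau dk dk1; rewrite spherical_helix_indicatrix.
assert (dtau : forall t, in_itv a b t -> is_derive tau t (- m * k1 t)).
{ intros t Ht; apply (is_derive_ext_itv a b (fun u => A - m * k u)); [exact Ht| |].
  - intros u Hu; symmetry; now apply Htau.
  - eapply is_derive_eq.
    + apply is_derive_subR; [apply is_derive_const|].
      apply is_derive_mulR; [apply is_derive_const|now apply dk].
    + unfold zero; simpl; ring. }
set (r := fun t => - A * k1 t / (w t * (w t * w t))).
assert (Hr : forall t, in_itv a b t -> r t = torsion (tangent c) t / curvature (tangent c) t).
{ intros t Ht; assert (Hk := curvature_gt0 _ _ _ Hc t Ht); fold k in Hk.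
  assert (Hw := darboux_gt0 t Ht).
  rewrite (torsion_indicatrix t _ _ Ht (dk t Ht) (dtau t Ht)), curvature_indicatrix by exact Ht.
  unfold r; rewrite Htau by exact Ht; field; lra. }
set (E := fun t => k2 t * (k t ^ 2 + tau t ^ 2) - 3 * k1 t ^ 2 * (k t - m * tau t)).
assert (dr : forall t, in_itv a b t -> is_derive r t (- A * E t / w t ^ 5)).
{ intros t Ht; assert (Hk := curvature_gt0 _ _ _ Hc t Ht); fold k in Hk.
  assert (Hw := darboux_gt0 t Ht).
  (* From [w w' = k k' + tau tau'] with [tau' = - m k']. *)
  assert (dw : is_derive w t (k1 t * (k t - m * tau t) / w t)).
  { eapply is_derive_eq.
    - apply is_derive_sqrt.
      + exact (is_derive_addR _ _ _ _ _
          (is_derive_mulR _ _ _ _ _ (dk t Ht) (dk t Ht))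
          (is_derive_mulR _ _ _ _ _ (dtau t Ht) (dtau t Ht))).
      + nra.
    - cbv beta; fold (w t); field; lra. }
  eapply is_derive_eq.
  { apply is_derive_div.
    - apply is_derive_mulR; [apply is_derive_const|now apply dk1].
    - apply is_derive_mulR; [exact dw|apply is_derive_mulR; exact dw].
    - cbv beta; repeat apply Rmult_integral_contrapositive_currified; lra. }
  cbv beta; unfold E; replace (k t ^ 2 + tau t ^ 2) with (w t * w t) by (rewrite darboux_sqr; ring).
  unfold zero; simpl; field; lra. }
split.
- intros [q Hq] t Ht; change (E t = 0).
  assert (Hw := darboux_gt0 t Ht).
  assert (dr0 : is_derive r t 0).
  { apply (is_derive_ext_itv a b (fun _ => q)); [exact Ht| |apply (is_derive_const q t)].
    intros u Hu; now rewrite Hr, Hq. }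
  assert (Z := is_derive_uniq _ _ _ _ (dr t Ht) dr0).
  replace (E t) with (- (w t ^ 5) / A * (- A * E t / w t ^ 5)) by (field; lra).
  rewrite Z; ring.
- intros HE.
  (* The constant is the ratio at some base point; on an empty interval any value will do. *)
  destruct (Rbar_lt_dec a b) as [Hab|Hab].
  + destruct (in_itv_inhabited a b Hab) as [t0 Ht0].
    exists (r t0); intros t Ht; rewrite <- Hr by exact Ht.
    apply (constant_on_itv a b); [|exact Ht|exact Ht0].
    intros u Hu; eapply is_derive_eq; [now apply dr|].
    unfold E; rewrite HE by exact Hu; unfold Rdiv; ring.
  + exists 0; intros t [Ha Hb]; destruct Hab; exact (Rbar_lt_trans _ _ _ Ha Hb).
Qed.

End TangentIndicatrix.

(** * Bertrand pairs *)

(** Turns the filter form of the derivative into a plain inequality. The limit point quantified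
    there can only be [x], as neighbourhood filters separate points. *)
Lemma is_derive_approx (f : R -> R) (x l : R) :
  is_derive f x l <->
  forall e : posreal, locally x (fun u => Rabs (f u - f x - (u - x) * l) <= e * Rabs (u - x)).
Proof.
split.
- intros [_ H] e; exact (H x (fun P HP => HP) e).
- intros H; split; [apply (is_linear_scal_l (K := R_AbsRing) (V := R_NormedModule))|].
  intros y Hy e.
  assert (E : x = y) by (apply (is_filter_lim_locally_unique x y); exact Hy).
  rewrite <- E; exact (H e).
Qed.

(* [|G(phi u) - G(phi s)|] bounds [|phi u - phi s|] near [s] because [l <> 0], so the
   error made by replacing [G o phi] with [l phi] is negligible against [|u - s|]. *)
Lemma is_derive_lift (G phi : R -> R) (s l m : R) :
  is_derive G (phi s) l -> l <> 0 -> continuous phi s ->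
  is_derive (fun u => G (phi u)) s m -> is_derive phi s (m / l).
Proof.
intros dG Hl Cphi dGphi.
apply is_derive_approx; intros e.
assert (Hl' : 0 < Rabs l) by now apply Rabs_pos_lt.
assert (Hm := Rabs_pos m).
assert (He := cond_pos e).
(* [C] will bound [|h| / |v|], the increment of [phi] over that of the parameter. The first entries
   of the two minima give this bound; the second ones make each error at most [e |l| |v| / 2]. *)
set (C := 2 * (Rabs m + 1) / Rabs l).
assert (HC : 0 < C) by (apply Rdiv_lt_0_compat; lra).
assert (He1 : 0 < Rmin (Rabs l / 2) (e * Rabs l / (2 * C))).
{ apply Rmin_pos; [lra|]; apply Rdiv_lt_0_compat; [nra|lra]. }
assert (He2 : 0 < Rmin 1 (e * Rabs l / 2)) by (apply Rmin_pos; nra).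
set (e1 := mkposreal _ He1); set (e2 := mkposreal _ He2).
assert (H1 : locally s (fun u =>
  Rabs (G (phi u) - G (phi s) - (phi u - phi s) * l) <= e1 * Rabs (phi u - phi s)))
  by exact (Cphi _ (proj1 (is_derive_approx _ _ _) dG e1)).
assert (H2 := proj1 (is_derive_approx _ _ _) dGphi e2).
apply filter_imp with (2 := filter_and _ _ H1 H2); intros u [A1 A2].
clear H1 H2 dG Cphi dGphi; simpl in A1, A2.
set (D := G (phi u) - G (phi s)) in *; set (h := phi u - phi s) in *.
set (v := u - s) in *.
assert (B1 := Rmin_l (Rabs l / 2) (e * Rabs l / (2 * C))).
assert (B2 := Rmin_r (Rabs l / 2) (e * Rabs l / (2 * C))).
assert (B3 := Rmin_l 1 (e * Rabs l / 2)).
assert (B4 := Rmin_r 1 (e * Rabs l / 2)).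
set (x1 := Rmin (Rabs l / 2) _) in *; set (x2 := Rmin 1 _) in *.
assert (Hh := Rabs_pos h); assert (Hv := Rabs_pos v).
assert (HD : Rabs D <= (Rabs m + 1) * Rabs v).
{ replace D with (v * m + (D - v * m)) by ring.
  eapply Rle_trans; [apply Rabs_triang|]; rewrite Rabs_mult; nra. }
assert (Hhv : Rabs h <= C * Rabs v).
{ assert (Rabs h * Rabs l <= Rabs D + Rabs l / 2 * Rabs h).
  { rewrite <- Rabs_mult; replace (h * l) with (D + - (D - h * l)) by ring.
    eapply Rle_trans; [apply Rabs_triang|]; rewrite Rabs_Ropp; nra. }
  apply Rmult_le_reg_l with (Rabs l / 2); [lra|].
  replace (Rabs l / 2 * (C * Rabs v)) with ((Rabs m + 1) * Rabs v)
    by (unfold C; field; lra).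
  lra. }
assert (K : Rabs (h * l - v * m) <= e * Rabs l * Rabs v).
{ replace (h * l - v * m) with (- (D - h * l) + (D - v * m)) by ring.
  eapply Rle_trans; [apply Rabs_triang|]; rewrite Rabs_Ropp.
  assert (x1 * Rabs h <= e * Rabs l / 2 * Rabs v); [|nra].
  replace (e * Rabs l / 2 * Rabs v) with (e * Rabs l / (2 * C) * (C * Rabs v))
    by (field; lra).
  apply Rmult_le_compat; lra. }
replace (h - v * (m / l)) with ((h * l - v * m) / l) by (field; exact Hl).
unfold Rdiv; rewrite Rabs_mult, Rabs_inv.
apply Rmult_le_reg_r with (Rabs l); [exact Hl'|].
rewrite Rmult_assoc, Rinv_l by lra; lra.
Qed.

Section BertrandPair.

Variables (a b a' b' : Rbar) (g g' : R -> vec3) (phi : R -> R) (lambda eps : R).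
Hypotheses (Hg : frenet_curve a b g) (Harc : arclength_param a b g).
Hypotheses (Hg' : frenet_curve a' b' g') (Harc' : arclength_param a' b' g').
Hypotheses (Hphi : forall s, in_itv a b s -> in_itv a' b' (phi s)).
Hypotheses (Cphi : forall s, in_itv a b s -> continuous phi s).
Hypotheses (Hlambda : lambda <> 0) (Heps : eps * eps = 1).
Hypothesis HN : forall s, in_itv a b s -> normal g s = scal eps (normal g' (phi s)).
Hypothesis Hmate : forall s, in_itv a b s ->
  g' (phi s) = plus (g s) (scal lambda (normal g s)).

(** The velocity of the mate in the parameter [s], that is [(gamma + lambda N)']. Its component [p]
    along the tangent of the mate is the candidate for [phi'], as [phi] is only assumed
    continuous. *)
Let V (s : R) :=
  plus (scal (1 - lambda * curvature g s) (tangent g s))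
       (scal (lambda * torsion g s) (binormal g s)).
Let p (s : R) := dot (V s) (tangent g' (phi s)).

Lemma is_vderive_mate (s : R) : in_itv a b s -> is_vderive (fun u => g' (phi u)) s (V s).
Proof.
intros Hs.
apply (is_vderive_ext_itv a b (fun u => plus (g u) (scal lambda (normal g u)))).
- exact Hs.
- intros u Hu; symmetry; now apply Hmate.
- eapply is_vderive_eq.
  + apply is_vderive_plus; [now apply (is_vderive_curve_tangent a b)|].
    apply is_vderive_scal; [apply is_derive_const|now apply (is_vderive_normal a b)].
  + unfold V, zero; simpl; vec_ring.
Qed.

(** With [u] frozen as the unit tangent of the mate at [phi s], the function [<g', u>] has
    derivative 1 there, while its composite with [phi] has derivative [<V s, u> = p s]. Hence
    [is_derive_lift] applies. *)
Lemma is_derive_correspondence (s : R) : in_itv a b s -> is_derive phi s (p s).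
Proof.
intros Hs; assert (Hs' := Hphi s Hs).
set (u := tangent g' (phi s)).
assert (Cu := fun t => is_vderive_const u t).
assert (uu : dot u u = 1) by now apply (dot_tangent_self a' b').
eapply is_derive_eq.
- apply (is_derive_lift (fun t => dot (g' t) u) phi s 1 (p s)); [|lra|now apply Cphi|].
  + eapply is_derive_eq.
    * apply is_derive_dot; [now apply (is_vderive_curve_tangent a' b')|apply Cu].
    * cbv beta; fold u; rewrite uu, dot_scal_r; ring.
  + eapply is_derive_eq.
    * apply (is_derive_dot (fun t => g' (phi t))); [now apply is_vderive_mate|apply Cu].
    * unfold p; fold u; rewrite dot_scal_r; ring.
- field.
Qed.

(** Both sides are the derivative of [g'] composed with [phi]: by the chain rule, and from
    [gamma + lambda N]. *)
Lemma mate_tangent (s : R) : in_itv a b s -> scal (p s) (tangent g' (phi s)) = V s.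
Proof.
intros Hs.
assert (H1 := is_vderive_comp _ _ _ _ _
  (is_vderive_curve_tangent _ _ _ Hg' Harc' _ (Hphi s Hs)) (is_derive_correspondence s Hs)).
rewrite <- (is_vderive_unique _ _ _ H1).
now apply is_vderive_unique, is_vderive_mate.
Qed.

Lemma mate_normal (s : R) : in_itv a b s -> normal g' (phi s) = scal eps (normal g s).
Proof.
intros Hs; rewrite HN by exact Hs.
apply vec3_ext; autorewrite with coord; rewrite <- Rmult_assoc, Heps; ring.
Qed.

Lemma mate_tangent_dot_normal (s : R) :
  in_itv a b s -> dot (tangent g' (phi s)) (normal g s) = 0.
Proof.
intros Hs; rewrite HN, dot_scal_r, (dot_tangent_normal a' b') by auto; ring.
Qed.

(** The tangent of the mate is orthogonal to [N], and its derivative is parallel to [N], as are [T']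
    and [B']. So its products with [T] and [B] have zero derivative; [c] and [d] are their values at
    [s0]. *)
Lemma mate_tangent_constant (s0 : R) :
  in_itv a b s0 ->
  exists c d, c ^ 2 + d ^ 2 = 1 /\ forall s, in_itv a b s ->
    tangent g' (phi s) = plus (scal c (tangent g s)) (scal d (binormal g s)).
Proof.
intros Hs0.
set (U := fun s => tangent g' (phi s)).
assert (dU : forall s, in_itv a b s -> is_vderive U s
  (scal (p s) (scal (curvature g' (phi s)) (scal eps (normal g s))))).
{ intros s Hs; rewrite <- mate_normal by exact Hs.
  apply (is_vderive_comp (tangent g')); [|now apply is_derive_correspondence].
  apply (is_vderive_tangent a' b'); auto. }
exists (dot (tangent g s0) (U s0)), (dot (binormal g s0) (U s0)).
assert (HU : forall s, in_itv a b s -> U s =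
  plus (scal (dot (tangent g s0) (U s0)) (tangent g s))
       (scal (dot (binormal g s0) (U s0)) (binormal g s))).
{ intros s Hs.
  rewrite (orthonormal_expand _ _ (U s) (dot_tangent_self _ _ _ Harc s Hs)
    (dot_normal_self _ _ _ Hg Harc s Hs) (dot_tangent_normal _ _ _ Hg Harc s Hs)) at 1.
  fold (binormal g s).
  unfold U at 2; rewrite mate_tangent_dot_normal by exact Hs.
  rewrite (dot_sym (U s)), (dot_sym (U s)).
  rewrite (constant_on_itv a b (fun u => dot (tangent g u) (U u))) with (s := s) (t := s0);
    [|intros t Ht|exact Hs|exact Hs0].
  rewrite (constant_on_itv a b (fun u => dot (binormal g u) (U u))) with (s := s) (t := s0);
    [|intros t Ht|exact Hs|exact Hs0].
  - vec_ring.
  - eapply is_derive_eq.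
    + apply is_derive_dot; [now apply (is_vderive_binormal a b)|now apply dU].
    + autorewrite with dotlin; rewrite (dot_sym (normal g t)); unfold U.
      rewrite mate_tangent_dot_normal by exact Ht.
      rewrite (dot_sym (binormal g t)); unfold binormal; rewrite dot_cross_r; ring.
  - eapply is_derive_eq.
    + apply is_derive_dot; [now apply (is_vderive_tangent a b)|now apply dU].
    + autorewrite with dotlin; rewrite (dot_sym (normal g t)); unfold U.
      rewrite mate_tangent_dot_normal by exact Ht.
      rewrite (dot_tangent_normal a b) by assumption; ring. }
split; [|exact HU].
assert (E : dot (U s0) (U s0) = 1) by exact (dot_tangent_self _ _ _ Harc' _ (Hphi s0 Hs0)).
rewrite (HU s0 Hs0) in E at 1.
rewrite dot_plus_l, !dot_scal_l in E.
rewrite <- E; ring.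
Qed.

(** The first two relations are the components of [mate_tangent] along [T] and [B]; nonvanishing
    torsion then makes [q d] nonzero. The last two come from differentiating the orthogonality of
    [N] to the tangent and to the binormal of the mate. *)
Lemma bertrand_relations (s0 : R) :
  in_itv a b s0 -> nonplanar a b g ->
  exists (c d : R) (q : R -> R), c ^ 2 + d ^ 2 = 1 /\ d <> 0 /\
    forall s, in_itv a b s ->
      is_derive phi s (q s) /\ q s <> 0 /\
      q s * c = 1 - lambda * curvature g s /\
      q s * d = lambda * torsion g s /\
      lambda * eps * q s * curvature g' (phi s) = c - q s /\
      lambda * q s * torsion g' (phi s) = d.
Proof.
intros Hs0 Hplanar.
destruct (mate_tangent_constant s0 Hs0) as (c & d & Hcd & HU).
assert (Hpcd : forall s, in_itv a b s -> p s * c = 1 - lambda * curvature g s /\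
                                         p s * d = lambda * torsion g s).
{ intros s Hs; assert (E := mate_tangent s Hs); rewrite HU in E by exact Hs.
  assert (TB : dot (tangent g s) (binormal g s) = 0) by apply dot_cross_l.
  assert (TT := dot_tangent_self _ _ _ Harc s Hs).
  assert (BB := dot_binormal_self _ _ _ Hg Harc s Hs).
  split.
  - assert (E1 := f_equal (dot (tangent g s)) E); unfold V in E1.
    autorewrite with dotlin in E1; rewrite TT, TB in E1; lra.
  - assert (E1 := f_equal (dot (binormal g s)) E); unfold V in E1.
    autorewrite with dotlin in E1; rewrite BB, (dot_sym (binormal g s)), TB in E1; lra. }
assert (Hp0 : forall s, in_itv a b s -> p s * d <> 0).
{ intros s Hs; rewrite (proj2 (Hpcd s Hs)); apply Rmult_integral_contrapositive_currified;
    [exact Hlambda|now apply Hplanar]. }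
exists c, d, p; split; [exact Hcd|].
split; [intros E; apply (Hp0 s0 Hs0); rewrite E; ring|].
intros s Hs; assert (Hs' := Hphi s Hs).
destruct (Hpcd s Hs) as [Hc Hd].
split; [now apply is_derive_correspondence|].
split; [intros E; apply (Hp0 s Hs); rewrite E; ring|].
split; [exact Hc|split; [exact Hd|]].
assert (dphi := is_derive_correspondence s Hs).
assert (TB : dot (tangent g s) (binormal g s) = 0) by apply dot_cross_l.
assert (TN := dot_tangent_normal _ _ _ Hg Harc s Hs).
assert (TT := dot_tangent_self _ _ _ Harc s Hs).
assert (BB := dot_binormal_self _ _ _ Hg Harc s Hs).
assert (NN := dot_normal_self _ _ _ Hg Harc s Hs).
assert (HV := mate_normal s Hs).
assert (dN := is_vderive_normal _ _ _ Hg Harc s Hs).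
split.
- assert (D := is_derive_dot _ _ _ _ _ dN
    (is_vderive_comp _ _ _ _ _ (is_vderive_tangent _ _ _ Hg' Harc' _ Hs') dphi)).
  assert (D0 : is_derive (fun u => dot (normal g u) (tangent g' (phi u))) s 0).
  { apply (is_derive_ext_itv a b (fun _ => 0)); [exact Hs| |apply (is_derive_const 0 s)].
    intros u Hu; rewrite dot_sym, mate_tangent_dot_normal by exact Hu; reflexivity. }
  assert (E := is_derive_uniq _ _ _ _ D D0); clear D D0; cbv beta in E.
  rewrite HU, HV in E by exact Hs; autorewrite with dotlin in E.
  rewrite (dot_sym (binormal g s) (tangent g s)), TT, TB, BB, NN in E.
  assert (E1 : p s * eps * curvature g' (phi s) = curvature g s * c - torsion g s * d) by lra.
  replace (lambda * eps * p s * curvature g' (phi s))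
    with (lambda * (p s * eps * curvature g' (phi s))) by ring.
  rewrite E1.
  replace (lambda * (curvature g s * c - torsion g s * d))
    with (lambda * curvature g s * c - lambda * torsion g s * d) by ring.
  rewrite <- Hd; replace (lambda * curvature g s) with (1 - p s * c) by lra.
  replace (c - p s) with (c - p s * (c ^ 2 + d ^ 2)) by (rewrite Hcd; ring); ring.
- assert (D := is_derive_dot _ _ _ _ _ dN
    (is_vderive_comp _ _ _ _ _ (is_vderive_binormal _ _ _ Hg' Harc' _ Hs') dphi)).
  assert (D0 : is_derive (fun u => dot (normal g u) (binormal g' (phi u))) s 0).
  { apply (is_derive_ext_itv a b (fun _ => 0)); [exact Hs| |apply (is_derive_const 0 s)].
    intros u Hu; rewrite HN, dot_scal_l by exact Hu.
    unfold binormal; rewrite dot_cross_r; ring. }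
  assert (E := is_derive_uniq _ _ _ _ D D0); clear D D0; cbv beta in E.
  (* The cross product of [c T + d B] with [eps N], using [B x N = - T]. *)
  assert (W : binormal g' (phi s) =
    scal eps (plus (scal c (binormal g s)) (scal (- d) (tangent g s)))).
  { unfold binormal at 1; rewrite HU, HV by exact Hs.
    rewrite cross_scal_r, cross_plus_l, !cross_scal_l.
    unfold binormal at 1; rewrite cross_cross_l, NN, TN; unfold binormal; vec_ring. }
  rewrite W, HV in E; autorewrite with dotlin in E.
  rewrite (dot_sym (binormal g s) (tangent g s)), TT, TB, BB, NN in E.
  assert (E1 : eps * (p s * torsion g' (phi s))
               = eps * (curvature g s * d + torsion g s * c)) by lra.
  apply Rmult_eq_reg_l in E1; [|intros E0; rewrite E0 in Heps; lra].
  replace (lambda * p s * torsion g' (phi s))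
    with (lambda * (p s * torsion g' (phi s))) by ring.
  rewrite E1.
  replace (lambda * (curvature g s * d + torsion g s * c))
    with (lambda * curvature g s * d + lambda * torsion g s * c) by ring.
  rewrite <- Hd; replace (lambda * curvature g s) with (1 - p s * c) by lra; ring.
Qed.

End BertrandPair.

(** * From the helix criterion on the curve to the equation on its mate *)

(** The algebraic core at one pair of corresponding points: [k0], [tau0] belong to the curve and
    [K], [tau] to its mate, and [d * eps / c] stands for the value of [g]. The right side is the
    criterion of [indicatrix_helix_iff] with [m = d / c], up to a nonzero factor. *)
Lemma helix_condition_transfer (c d q lambda eps k1 k2 k0 tau0 K tau K1 K2 : R) :
  c <> 0 -> q <> 0 -> lambda <> 0 -> eps = 1 \/ eps = -1 -> c ^ 2 + d ^ 2 = 1 ->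
  q * c = 1 - lambda * k0 -> q * d = lambda * tau0 ->
  K <> 0 -> lambda * eps * q * K = c - q -> lambda * q * tau = d ->
  K1 = eps * k1 / q ^ 3 -> K2 = eps * (k2 * q + 3 * lambda * k1 ^ 2 / c) / q ^ 5 ->
  K2 * K * (tau / K) ^ 2 - 3 * K1 ^ 2 * (d * eps / c) * (tau / K) + K2 * K - 3 * K1 ^ 2 =
  eps / (q ^ 6 * K) *
    (k2 * (k0 ^ 2 + tau0 ^ 2) - 3 * k1 ^ 2 * (k0 - d / c * tau0)).
Proof.
intros Hc Hq Hl Heps Hcd Ek0 Et0 HK EK Et -> ->.
(* Writing [1] as [S = c^2 + d^2] in [k0] makes both sides homogeneous, so the relation
   [S = 1] is only needed to drop a factor [/ S]. *)
set (S := c ^ 2 + d ^ 2) in *.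
assert (Ek : k0 = (S - q * c) / lambda) by (rewrite Hcd, Ek0; field; exact Hl).
assert (Et0' : tau0 = q * d / lambda) by (rewrite Et0; field; exact Hl).
assert (Et' : tau = d / (lambda * q)) by (rewrite <- Et; field; auto).
assert (He : eps * eps = 1) by (destruct Heps as [-> | ->]; ring).
assert (EK' : K = eps * (c - q) / (lambda * q)).
{ rewrite <- EK; replace (eps * (lambda * eps * q * K)) with (eps * eps * (lambda * q * K)) by ring.
  rewrite He; field; auto. }
assert (Hcq : c - q <> 0).
{ intros E0; apply HK; rewrite EK', E0; unfold Rdiv; ring. }
replace (eps / (q ^ 6 * K)) with (eps / (q ^ 6 * K * S)) by (rewrite Hcd; field; auto).
assert (HS : S <> 0) by lra.
rewrite Ek, Et0', Et', EK'; unfold S in *.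
(* [field] cannot use [eps * eps = 1], so the two signs are treated separately. *)
destruct Heps as [-> | ->]; field; repeat split; auto; lra.
Qed.

Theorem theorem6 :
  forall (a b a' b' : Rbar) (gamma gammat : R -> vec3),
    let kappa : R -> R := curvature gammat in
    let tau : R -> R := torsion gammat in
    let f : R -> R := fun t => tau t / kappa t in
    let g : R -> R := fun t => Derive tau t / Derive kappa t in
    Rbar_lt a b ->
    Rbar_lt a' b' ->
    bertrand_pair a b a' b' gamma gammat ->
    ~ constant_ratio a b gamma ->
    ~ constant_ratio a' b' gammat ->
    nonplanar a b gamma ->
    nonplanar a' b' gammat ->
    (forall t, in_itv a' b' t -> Derive kappa t <> 0) ->
    (forall t, in_itv a' b' t -> f t <> 0) ->
    (forall t, in_itv a' b' t -> g t <> f t) ->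
    (spherical_helix a b (tangent gamma) <->
     forall t, in_itv a' b' t ->
       Derive_n kappa 2 t * kappa t * f t ^ 2
       - 3 * Derive kappa t ^ 2 * g t * f t
       + Derive_n kappa 2 t * kappa t
       - 3 * Derive kappa t ^ 2 = 0).
Proof.
intros a b a' b' gamma gammat kappa tau f g Hab _ Hpair _ _ Hplanar _ Hkappa' _ _.
destruct Hpair as (Hg & Harc & Hg' & Harc' & phi & lambda & eps & Hcorr & Hl & Heps & HN & Hmate).
destruct Hcorr as (Hphi & Hsurj & Cphi).
assert (Hee : eps * eps = 1) by (destruct Heps as [-> | ->]; ring).
assert (He0 : eps <> 0) by (destruct Heps as [-> | ->]; lra).
destruct (in_itv_inhabited a b Hab) as [s0 Hs0].
destruct (bertrand_relations a b a' b' gamma gammat phi lambda eps Hg Harc Hg' Harc'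
  Hphi Cphi Hl Hee HN Hmate s0 Hs0 Hplanar) as (c & d & q & Hcd & Hd & Hrel).
fold kappa tau in Hrel.
set (kappa0 := curvature gamma) in *; set (tau0 := torsion gamma) in *.
(* Surjectivity carries the relations, known at points [phi s], to the whole interval of the
   mate. *)
assert (Hpre : forall t, in_itv a' b' t -> exists s, in_itv a b s /\ phi s = t).
{ intros t Ht; destruct (Hsurj t Ht) as (s & H & _); now exists s. }
(* If [c = 0], then [lambda eps q kappa = - q] makes the curvature of the mate constant, against
   [Derive kappa <> 0]. *)
assert (Hc : c <> 0).
{ intros E; apply (Hkappa' (phi s0) (Hphi s0 Hs0)); apply is_derive_unique.
  apply (is_derive_ext_itv a' b' (fun _ => - / (lambda * eps)));
    [now apply Hphi| |apply (is_derive_const (- / (lambda * eps)) (phi s0))].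
  intros t Ht; destruct (Hpre t Ht) as (s & Hs & <-).
  destruct (Hrel s Hs) as (_ & Hq & _ & _ & EK & _); rewrite E in EK.
  apply (Rmult_eq_reg_l (lambda * eps * q s)); [rewrite EK; field; auto|].
  repeat apply Rmult_integral_contrapositive_currified; assumption. }
destruct (curvature_derive2 a b gamma Hg Harc) as (k1 & k2 & Hk).
destruct (curvature_derive2 a' b' gammat Hg' Harc') as (K1 & K2 & HK).
fold kappa in HK; fold kappa0 in Hk.
assert (HKgt : forall t, in_itv a' b' t -> kappa t <> 0) by apply Hg'.
assert (DK : forall t, in_itv a' b' t -> Derive kappa t = K1 t).
{ intros t Ht; apply is_derive_unique; now apply HK. }
assert (DK2 : forall t, in_itv a' b' t -> Derive_n kappa 2 t = K2 t).
{ intros t Ht; apply (is_derive_unique (Derive kappa)).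
  apply (is_derive_ext_itv a' b' K1); [exact Ht| |now apply HK].
  intros u Hu; symmetry; now apply DK. }
(* Eliminating [q] from the last two relations shows that the torsion of the mate is affine in its
   curvature. *)
assert (Dtau : forall t, in_itv a' b' t -> Derive tau t = d * eps / c * K1 t).
{ intros t Ht; apply is_derive_unique.
  apply (is_derive_ext_itv a' b' (fun u => d / (lambda * c) + d * eps / c * kappa u)).
  - exact Ht.
  - intros u Hu; destruct (Hpre u Hu) as (s & Hs & <-).
    destruct (Hrel s Hs) as (_ & Hq & _ & _ & EK & Et).
    apply (Rmult_eq_reg_l (lambda * q s));
      [|apply Rmult_integral_contrapositive_currified; assumption].
    rewrite Et.
    replace (lambda * q s * (d / (lambda * c) + d * eps / c * kappa (phi s)))
      with (d / c * (q s + lambda * eps * q s * kappa (phi s))) by (field; auto).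
    rewrite EK; field; exact Hc.
  - eapply is_derive_eq.
    + apply is_derive_addR; [apply is_derive_const|].
      apply is_derive_mulR; [apply is_derive_const|apply (proj1 (HK t Ht))].
    + unfold zero; simpl; ring. }
assert (dq : forall s, in_itv a b s -> is_derive q s (- (lambda / c) * k1 s)).
{ intros s Hs; apply (is_derive_ext_itv a b (fun u => / c - lambda / c * kappa0 u)).
  - exact Hs.
  - intros u Hu; destruct (Hrel u Hu) as (_ & _ & Ec & _).
    replace (/ c - lambda / c * kappa0 u) with ((1 - lambda * kappa0 u) / c) by (field; auto).
    rewrite <- Ec; field; exact Hc.
  - eapply is_derive_eq.
    + apply is_derive_subR; [apply is_derive_const|].
      apply is_derive_mulR; [apply is_derive_const|apply (proj1 (Hk s Hs))].
    + unfold zero; simpl; ring. }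
(* Differentiate [kappa (phi s) = eps / lambda (c / q - 1)] with [q' = - (lambda / c) k1]; the chain
   rule supplies one more factor [q] to divide by. *)
assert (EK1 : forall s, in_itv a b s -> K1 (phi s) = eps * k1 s / q s ^ 3).
{ intros s Hs; destruct (Hrel s Hs) as (dphi & Hq & _).
  assert (D := is_derive_comp kappa phi s _ _ (proj1 (HK _ (Hphi s Hs))) dphi).
  assert (D1 : is_derive (fun u => kappa (phi u)) s (eps * k1 s / q s ^ 2)).
  { apply (is_derive_ext_itv a b (fun u => eps / lambda * (c * / q u - 1))).
    - exact Hs.
    - intros u Hu; destruct (Hrel u Hu) as (_ & Hqu & _ & _ & EK & _).
      replace (eps / lambda * (c * / q u - 1)) with (eps * (c - q u) / (lambda * q u))
        by (field; auto).
      rewrite <- EK.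
      replace (eps * (lambda * eps * q u * kappa (phi u)))
        with (eps * eps * (lambda * q u * kappa (phi u))) by ring.
      rewrite Hee; field; auto.
    - eapply is_derive_eq.
      + apply is_derive_mulR; [apply is_derive_const|].
        apply is_derive_subR; [|apply is_derive_const].
        apply is_derive_mulR; [apply is_derive_const|].
        exact (is_derive_inv _ _ _ (dq s Hs) Hq).
      + unfold zero; simpl; field; auto. }
  assert (E := is_derive_uniq _ _ _ _ D D1).
  change (scal (q s) (K1 (phi s))) with (q s * K1 (phi s)) in E.
  apply (Rmult_eq_reg_l (q s)); [rewrite E; field; exact Hq|exact Hq]. }
(* The same computation once more, starting from the formula just found for [K1]. *)
assert (EK2 : forall s, in_itv a b s ->
  K2 (phi s) = eps * (k2 s * q s + 3 * lambda * k1 s ^ 2 / c) / q s ^ 5).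
{ intros s Hs; destruct (Hrel s Hs) as (dphi & Hq & _).
  assert (D := is_derive_comp K1 phi s _ _ (proj2 (HK _ (Hphi s Hs))) dphi).
  assert (D1 : is_derive (fun u => K1 (phi u)) s
                 (eps * (k2 s * q s + 3 * lambda * k1 s ^ 2 / c) / q s ^ 4)).
  { apply (is_derive_ext_itv a b (fun u => eps * k1 u / (q u * (q u * q u)))).
    - exact Hs.
    - intros u Hu; rewrite EK1 by exact Hu; f_equal; ring.
    - eapply is_derive_eq.
      + apply is_derive_div.
        * apply is_derive_mulR; [apply is_derive_const|exact (proj2 (Hk s Hs))].
        * exact (is_derive_mulR _ _ _ _ _ (dq s Hs)
            (is_derive_mulR _ _ _ _ _ (dq s Hs) (dq s Hs))).
        * repeat apply Rmult_integral_contrapositive_currified; exact Hq.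
      + unfold zero; simpl; field; auto. }
  assert (E := is_derive_uniq _ _ _ _ D D1).
  change (scal (q s) (K2 (phi s))) with (q s * K2 (phi s)) in E.
  apply (Rmult_eq_reg_l (q s)); [rewrite E; field; auto|exact Hq]. }
assert (Key := fun s (Hs : in_itv a b s) =>
  let '(conj _ (conj Hq (conj Ec (conj Ed (conj EK Et))))) := Hrel s Hs in
  helix_condition_transfer c d (q s) lambda eps (k1 s) (k2 s) (kappa0 s) (tau0 s)
    (kappa (phi s)) (tau (phi s)) (K1 (phi s)) (K2 (phi s))
    Hc Hq Hl Heps Hcd Ec Ed (HKgt _ (Hphi s Hs)) EK Et (EK1 s Hs) (EK2 s Hs)).
assert (Hgf : forall t, in_itv a' b' t -> g t = d * eps / c).
{ intros t Ht; unfold g; rewrite Dtau, DK by exact Ht.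
  assert (K1 t <> 0) by (rewrite <- DK by exact Ht; now apply Hkappa').
  field; auto. }
(* Eliminating [q] from the first two relations yields the affine law of [indicatrix_helix_iff],
   with [A = d / (c lambda)] and [m = d / c]. *)
assert (Htau0 : forall s, in_itv a b s -> tau0 s = d / (c * lambda) - d / c * kappa0 s).
{ intros s Hs; destruct (Hrel s Hs) as (_ & _ & Ec & Ed & _).
  apply (Rmult_eq_reg_l lambda); [rewrite <- Ed|exact Hl].
  replace (lambda * (d / (c * lambda) - d / c * kappa0 s))
    with (d / c * (1 - lambda * kappa0 s)) by (field; auto).
  rewrite <- Ec; field; exact Hc. }
assert (HA : d / (c * lambda) <> 0).
{ unfold Rdiv; apply Rmult_integral_contrapositive_currified; [exact Hd|].
  apply Rinv_neq_0_compat, Rmult_integral_contrapositive_currified; assumption. }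
rewrite (indicatrix_helix_iff a b gamma Hg Harc _ _ k1 k2 HA Htau0
  (fun s Hs => proj1 (Hk s Hs)) (fun s Hs => proj2 (Hk s Hs))).
fold kappa0 tau0.
split.
- intros H t Ht; destruct (Hpre t Ht) as (s & Hs & <-).
  rewrite DK2, DK, Hgf by exact Ht; unfold f.
  rewrite Key, H by exact Hs; ring.
- intros H s Hs; assert (Ht := Hphi s Hs).
  specialize (H (phi s) Ht); rewrite DK2, DK, Hgf in H by exact Ht; unfold f in H.
  rewrite Key in H by exact Hs.
  (* The product of the factor [eps / (q^6 kappa)] with the criterion vanishes, and that factor is
     nonzero. *)
  destruct (Rmult_integral _ _ H) as [H0|H0]; [|exact H0].
  destruct (Hrel s Hs) as (_ & Hq & _).
  assert (N : eps / (q s ^ 6 * kappa (phi s)) <> 0); [|contradiction].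
  unfold Rdiv; apply Rmult_integral_contrapositive_currified; [exact He0|].
  apply Rinv_neq_0_compat, Rmult_integral_contrapositive_currified; [|now apply HKgt].
  now apply pow_nonzero.
Qed.
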